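(* Let $\lambda_2\ge\lambda_3\ge\dots\ge\lambda_t$ be a non-increasing sequence of positive integers and let $\epsilon>0$. Then there exist infinitely many integers $\lambda_1\ge\lambda_2$ such that, writing $\lambda=(\lambda_1,\lambda_2,\dots,\lambda_t)$ and $n=\lambda_1+\dots+\lambda_t$, there exists a non-empty $\lambda$-transitive set $D\subseteq S_n$ with $|D|/n!<\epsilon$.
   Context: $\Omega=\{1,\dots,n\}$ and $S_n=\mathrm{Sym}(\Omega)$. For an integer partition $\lambda=(\lambda_1\ge\dots\ge\lambda_k)$ of $n$ (positive parts), an ordered set partition of $\Omega$ of shape $\lambda$ is a tuple $P=(P_1,\dots,P_k)$ of pairwise disjoint subsets with union $\Omega$ and $|P_i|=\lambda_i$. A permutation $g$ takes $P$ to $Q$ if $gP_i=Q_i$ (as sets) for every $i$. A set $D\subseteq S_n$ is $\lambda$-transitive if there is a constant $r_\lambda$ such that, for any two ordered set partitions $P,Q$ of shape $\lambda$, $D$ contains exactly $r_\lambda$ permutations taking $P$ to $Q$. *)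

(* Defs.v *)
From HB Require Import structures.
From mathcomp Require Import all_boot all_fingroup.

Set Implicit Arguments.
Unset Strict Implicit.
Unset Printing Implicit Defensive.

Section LambdaTransitivity.
Variables (n : nat) (la : seq nat).

(* The underlying set is 'I_n = {0, ..., n-1}, and the parts of [la] are
   indexed from 0. For an integer partition [la], such a [P] exists only when
   [la] is a partition of [n]. *)
Definition ordered_set_partition (P : {ffun 'I_(size la) -> {set 'I_n}}) : Prop :=
  [/\ forall i j, i != j -> [disjoint P i & P j],
      \bigcup_i P i = [set: 'I_n]
    & forall i, #|P i| = nth 0 la i].

Definition takes (g : 'S_n) (P Q : {ffun 'I_(size la) -> {set 'I_n}}) : bool :=
  [forall i, g @: P i == Q i].

Definition lambda_transitive (D : {set 'S_n}) : Prop :=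
  exists r : nat, forall P Q : {ffun 'I_(size la) -> {set 'I_n}},
    ordered_set_partition P -> ordered_set_partition Q ->
    #|[set g in D | takes g P Q]| = r.

End LambdaTransitivity.

(* Main.v *)
Require Import Defs.
From HB Require Import structures.
From mathcomp Require Import all_boot all_order all_algebra all_fingroup.
From mathcomp Require Import boolp classical_sets cardinality reals.

Set Implicit Arguments.
Unset Strict Implicit.
Unset Printing Implicit Defensive.
Import Order.TTheory GRing.Theory Num.Theory.

(** Choose pairwise disjoint blocks [B_1], ..., [B_s], each with more points
    than a partition of shape [la] has parts.  In the subgroup [H] of the
    permutations that stabilise every block, being even on a given block is a
    condition that halves the group; transporting it to each coset [H g]
    through a coset representative gives every permutation [g] one parity per
    block.  Let [D] be the set of the permutations all of whose parities are
    even ([even_blocks]).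

    Given ordered set partitions [P] and [Q] of shape [la], the pigeonhole
    principle puts two points of each block in the same part of [P]
    ([same_part_in_block]).  Swapping these two points before applying [g]
    does not change whether [g] takes [P] to [Q] ([takes_tperm]), but it
    switches the parity of [g] on that block and on no other
    ([block_parity_tperm]).  The [s] swaps therefore act freely on the
    permutations taking [P] to [Q] and equidistribute the [2 ^ s] parity
    patterns ([card_even_blocks]): exactly a fraction [2 ^- s] of these
    permutations lies in [D].  As the number of permutations taking [P] to
    [Q] depends only on the shape ([card_takes_const]), [D] is
    [la]-transitive.  The same count on the whole symmetric group gives [D]
    density [2 ^- s].

    The blocks can have size [t + 1], where [t] is the number of parts, so
    there is room for [s] of them as soon as the first part is large, whatever
    [s] is; all large values of the first part work. *)

(** * Counting by independent sign flips *)

(** The maps [flip i] play the role of the basis vectors of an elementary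
    abelian 2-group that switches the flags one at a time; each further flag
    required to be off halves the count, since [flip i] exchanges the elements
    with flag [i] on and off without touching the flags already treated. *)
Lemma card_all_unflagged (T : finType) (I : eqType) (f : I -> T -> bool)
    (flip : I -> T -> T) (X : {set T}) (r : seq I) :
    (forall i, injective (flip i)) ->
    (forall i x, x \in X -> flip i x \in X) ->
    (forall i j x, f j (flip i x) = f j x (+) (i == j)) ->
  uniq r ->
  #|[set x in X | all (fun i => ~~ f i x) r]| * 2 ^ size r = #|X|.
Proof.
move=> flip_inj flipX f_flip.
elim: r => [_|i r IHr /= /andP[i_notin_r /IHr <-]].
  by rewrite muln1; apply: eq_card => x; rewrite inE andbT.
set Y := [set x in X | all _ r].
have flipY x : x \in Y -> flip i x \in Y.
  rewrite !inE => /andP[/flipX-> /allP fr]; apply/allP=> j jr.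
  have /negPf nij : i != j by apply: contraNneq i_notin_r => ->.
  by rewrite f_flip nij addbF fr.
have flip_le b :
    #|[set x in Y | f i x == b]| <= #|[set x in Y | f i x == ~~ b]|.
  rewrite -(card_imset _ (flip_inj i)).
  apply/subset_leq_card/fintype.subsetP => y /imsetP[x].
  rewrite inE => /andP[xY /eqP fx] ->; rewrite inE flipY //= f_flip fx eqxx.
  by rewrite addbT.
have eq_half :
    #|[set x in Y | f i x == true]| = #|[set x in Y | f i x == false]|.
  by apply/eqP; rewrite eqn_leq (flip_le true) (flip_le false).
rewrite expnS mulnA muln2 -addnn; congr (_ * _).
rewrite -[RHS](cardsID [set x | f i x]).
have ->: #|Y :&: [set x | f i x]| = #|[set x in Y | f i x == true]|.
  by apply: eq_card => x; rewrite !inE eqb_id.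
rewrite eq_half; congr (_ + _); apply: eq_card => x;
  by rewrite !inE; case: (f i x); rewrite ?andbF ?andbT.
Qed.

(** * Parities of a permutation on disjoint blocks *)

Lemma mem_tperm_disjoint (T I : finType) (B : I -> {set T}) i j a b x :
    (forall i j, i != j -> [disjoint B i & B j]) ->
    a \in B i -> b \in B i ->
  (tperm a b x \in B j) = (x \in B j).
Proof.
move=> B_disj aB bB; have ab : (a \in B j) = (b \in B j).
  have [<-|/B_disj dij] := eqVneq i j; first by rewrite aB bB.
  by rewrite !(disjointFr dij).
by case: tpermP => [->|->|].
Qed.

Section BlockParity.
Variables (T I : finType) (B : I -> {set T}).
Hypothesis B_disjoint : forall i j, i != j -> [disjoint B i & B j].

Local Open Scope group_scope.

Definition block_stabiliser : {group {perm T}} :=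
  (\bigcap_i 'N(B i | 'P))%G.

(** A permutation need not stabilise [B i], so its parity there is that of the
    element of [block_stabiliser] leading from the representative of its coset
    to it.  The choice of representatives does not affect how parities change
    under multiplication by [block_stabiliser]. *)
Definition block_parity (i : I) (g : {perm T}) : bool :=
  restr_perm (B i) (g * (repr (block_stabiliser :* g))^-1).

Definition even_blocks : {set {perm T}} :=
  [set g | all (fun i => ~~ block_parity i g) (enum I)].

Lemma tperm_block_stabiliser i a b :
  a \in B i -> b \in B i -> tperm a b \in block_stabiliser.
Proof.
move=> aB bB; apply/bigcapP=> j _; apply/astabsP=> x; rewrite /= apermE.
exact: (mem_tperm_disjoint _ _ B_disjoint aB bB).
Qed.

(** The transposition lies in [block_stabiliser], so [g] and its product with
    it share their coset representative, and the restriction to each block is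
    a morphism on [block_stabiliser]: the transposition contributes its own
    parity on the block that contains it and nothing elsewhere. *)
Lemma block_parity_tperm i j a b g :
    a != b -> a \in B i -> b \in B i ->
  block_parity j (tperm a b * g) = block_parity j g (+) (i == j).
Proof.
move=> ab aB bB; have tH := tperm_block_stabiliser aB bB.
have stabN k h : h \in block_stabiliser -> h \in 'N(B k | 'P).
  by move/bigcapP; apply.
rewrite /block_parity rcosetM rcoset_id // -mulgA morphM ?odd_permM; last 2 first.
- exact: stabN.
- apply: stabN; case: repr_rcosetP => h hH.
  by rewrite invMg mulKVg groupV.
rewrite addbC /=; congr (_ (+) _).
have [<-{j}|nij] := eqVneq i j.
  suff ->: restr_perm (B i) (tperm a b) = tperm a b by rewrite odd_tperm ab.
  apply/permP=> x; have [xB|xB] := boolP (x \in B i).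
    by rewrite restr_permE // stabN.
  rewrite (out_perm (restr_perm_on _ _) xB) // tpermD //.
    by apply: contraNneq xB => <-.
  by apply: contraNneq xB => <-.
suff ->: restr_perm (B j) (tperm a b) = 1 by rewrite odd_perm1.
apply/permP=> x; rewrite perm1; have [xB|xB] := boolP (x \in B j).
  rewrite restr_permE ?stabN // tpermD //.
    by apply: contraTneq xB => <-; rewrite (disjointFr (B_disjoint nij)).
  by apply: contraTneq xB => <-; rewrite (disjointFr (B_disjoint nij)).
by rewrite (out_perm (restr_perm_on _ _) xB).
Qed.

Lemma card_even_blocks (a b : I -> T) (X : {set {perm T}}) :
    (forall i, [/\ a i != b i, a i \in B i & b i \in B i]) ->
    (forall i g, g \in X -> tperm (a i) (b i) * g \in X) ->
  (#|[set g in X | g \in even_blocks]| * 2 ^ #|I| = #|X|)%N.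
Proof.
move=> abB tX.
rewrite -(@card_all_unflagged _ _ block_parity
            (fun i g => tperm (a i) (b i) * g) X (enum I)) ?enum_uniq //.
- by rewrite -cardT; congr (_ * _)%N; apply: eq_card => g; rewrite !inE.
- by move=> i; apply: mulgI.
- by move=> i j g; have [? ? ?] := abB i; apply: block_parity_tperm.
Qed.

End BlockParity.

(** * Permutations taking one ordered set partition to another *)

Section OrderedSetPartitions.
Variables (n : nat) (la : seq nat).
Implicit Types P Q : {ffun 'I_(size la) -> {set 'I_n}}.

Lemma partition_colouring P : ordered_set_partition P ->
  exists c : 'I_n -> 'I_(size la), forall i, P i = [set x | c x == i].
Proof.
case=> P_disj P_cover _.
have /fin_all_exists[c xPc] (x : 'I_n) : exists i, x \in P i.
  have /bigcupP[i _ xPi] : x \in \bigcup_i P i by rewrite P_cover inE.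
  by exists i.
exists c => i; apply/setP=> x; rewrite inE.
by have [<-|/P_disj d] := eqVneq (c x) i; rewrite ?xPc ?(disjointFr d).
Qed.

Lemma takes_colouring P Q (c d : 'I_n -> 'I_(size la)) (g : 'S_n) :
    (forall i, P i = [set x | c x == i]) ->
    (forall i, Q i = [set x | d x == i]) ->
  takes g P Q = [forall x, d (g x) == c x].
Proof.
move=> Pc Qd; apply/forallP/forallP => [gP x | gc i].
  have: g x \in Q (c x).
    by rewrite -(eqP (gP _)) mem_imset ?Pc ?inE //; exact: perm_inj.
  by rewrite Qd inE.
apply/eqP/setP=> y; rewrite -[y](permKV g); move: (g^-1%g y) => x.
by rewrite mem_imset ?Pc ?Qd ?inE ?(eqP (gc x)) //; exact: perm_inj.
Qed.

(** Two ordered set partitions of the same shape, seen as colourings, use each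
    colour equally often, so they are rearrangements of one another. *)
Lemma takes_exists P Q : ordered_set_partition P -> ordered_set_partition Q ->
  exists g : 'S_n, takes g P Q.
Proof.
move=> oP oQ; have [c Pc] := partition_colouring oP.
have [d Qd] := partition_colouring oQ.
have card_fib (e : 'I_n -> 'I_(size la)) R i : ordered_set_partition R ->
    (forall i, R i = [set x | e x == i]) ->
  count_mem i [tuple e x | x < n] = nth 0 la i.
  case=> _ _ <- ->; rewrite /= count_map -size_filter cardE.
  rewrite /enum_mem -?enumT filter_predT.
  by congr size; apply: eq_filter => x; rewrite /= inE.
have /tuple_permP[g gE]: perm_eq [tuple c x | x < n] [tuple d x | x < n].
  apply/allP=> i _ /=.
  by rewrite (card_fib c P) // (card_fib d Q).
exists g; rewrite (takes_colouring _ Pc Qd); apply/forallP => x.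
have /(congr1 (fun t => tnth t x)) := val_inj gE.
by rewrite !tnth_mktuple => ->.
Qed.

Lemma takesM P Q R (g h : 'S_n) :
  takes g P Q -> takes h Q R -> takes (g * h)%g P R.
Proof.
move=> /forallP gPQ /forallP hQR; apply/forallP=> i.
rewrite -(eqP (hQR i)) -(eqP (gPQ i)) -imset_comp.
by apply/eqP/eq_imset=> x; rewrite /= permM.
Qed.

(** Composing with a permutation taking [P'] to [P] on one side and one taking
    [Q] to [Q'] on the other injects the first set into the second. *)
Lemma card_takes_const P Q P' Q' :
    ordered_set_partition P -> ordered_set_partition Q ->
    ordered_set_partition P' -> ordered_set_partition Q' ->
  #|[set g | takes g P Q]| = #|[set g | takes g P' Q']|.
Proof.
move=> oP oQ oP' oQ'.
wlog suff le : P Q P' Q' oP oQ oP' oQ' /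
    #|[set g | takes g P Q]| <= #|[set g | takes g P' Q']|.
  by apply/eqP; rewrite eqn_leq !le.
have [h hP] := takes_exists oP' oP; have [k kQ] := takes_exists oQ oQ'.
have inj : injective (fun g : 'S_n => h * g * k)%g.
  by move=> g g' /mulIg/mulgI.
rewrite -(card_imset _ inj).
apply/subset_leq_card/fintype.subsetP => _ /imsetP[g + ->].
by rewrite !inE => gPQ; apply: takesM kQ; apply: takesM gPQ.
Qed.

Lemma takes_tperm P Q (g : 'S_n) i a b :
    ordered_set_partition P -> a \in P i -> b \in P i ->
  takes g P Q -> takes (tperm a b * g)%g P Q.
Proof.
move=> [P_disj _ _] aP bP; apply: takesM; apply/forallP=> j; apply/eqP.
apply/setP=> y; rewrite -{1}[y](tpermK a b) mem_imset; last exact: perm_inj.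
by rewrite (mem_tperm_disjoint _ _ P_disj aP bP).
Qed.

Lemma same_part_in_block P (K : {set 'I_n}) :
    ordered_set_partition P -> size la < #|K| ->
  exists i a b, [/\ a != b, a \in K, b \in K, a \in P i & b \in P i].
Proof.
move=> oP lt_la_K; have [c Pc] := partition_colouring oP.
have: ~~ dinjectiveb c K.
  apply: contraL lt_la_K => /dinjectiveP/card_in_image <-.
  by rewrite -leqNgt -[leqRHS]card_ord max_card.
case/dinjectivePn=> a aK [b /andP[/= ba bK] cab].
by exists (c a), a, b; rewrite !Pc !inE cab eqxx eq_sym; split.
Qed.

(** * Transitive sets of small density *)

(** Blocks with more points than [la] has parts always meet some part twice,
    which supplies a parity-switching swap for every [P] and every block. *)
Theorem even_blocks_transitive (I : finType) (B : I -> {set 'I_n}) :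
    (forall i j, i != j -> [disjoint B i & B j]) ->
    (forall i, size la < #|B i|) ->
  lambda_transitive la (even_blocks B).
Proof.
move=> B_disj la_B.
have halving P Q : ordered_set_partition P ->
    #|[set g in even_blocks B | takes g P Q]| * 2 ^ #|I|
    = #|[set g | takes g P Q]|.
  move=> oP.
  have /fin_all_exists[k /fin_all_exists[a /fin_all_exists[b abP]]] i :=
    same_part_in_block oP (la_B i).
  rewrite -(card_even_blocks B_disj (a := a) (b := b)
             (X := [set g | takes g P Q])).
  - by congr (_ * _); apply: eq_card => g; rewrite !inE andbC.
  - by move=> i; have [] := abP i; split.
  move=> i g; rewrite !inE; have [_ _ _ aP bP] := abP i.
  exact: takes_tperm aP bP.
have [[P0 [Q0 [oP0 oQ0]]] | no_osp] :=
    pselect (exists P0 Q0 : {ffun 'I_(size la) -> {set 'I_n}},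
      ordered_set_partition P0 /\ ordered_set_partition Q0).
  exists #|[set g in even_blocks B | takes g P0 Q0]| => P Q oP oQ.
  have pow_gt0 : 0 < 2 ^ #|I| by rewrite expn_gt0.
  apply/eqP; rewrite -(eqn_pmul2r pow_gt0).
  by rewrite !halving // (card_takes_const oP oQ oP0 oQ0).
by exists 0 => P Q oP oQ; case: no_osp; exists P, Q.
Qed.

End OrderedSetPartitions.

Lemma card_all_even_blocks (T I : finType) (B : I -> {set T}) :
    (forall i j, i != j -> [disjoint B i & B j]) ->
    (forall i, 1 < #|B i|) ->
  #|even_blocks B| * 2 ^ #|I| = (#|T|)`!.
Proof.
move=> B_disj B_gt1.
have /fin_all_exists[a /fin_all_exists[b abB]] i :
    exists a b, [/\ a != b, a \in B i & b \in B i].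
  have /card_gt1P[a [b [aB bB ab]]] := B_gt1 i.
  by exists a, b; split.
have := card_even_blocks B_disj (X := [set: {perm T}]%SET) abB.
have ->: #|[set: {perm T}]| = (#|T|)`!.
  rewrite -cardsT -card_perm; apply: eq_card => g; rewrite !inE.
  by apply/esym/fintype.subsetP=> x _; rewrite inE.
move=> <-.
  by congr (_ * _); apply: eq_card => g; rewrite !inE.
by move=> i g; rewrite !inE.
Qed.

Lemma exists_blocks (n s w : nat) : s * w <= n ->
  exists B : 'I_s -> {set 'I_n},
    (forall i j, i != j -> [disjoint B i & B j]) /\ forall i, #|B i| = w.
Proof.
move=> le_sw_n; have [->|w_gt0] := posnP w.
  exists (fun=> finset.set0); split=> [i j _|i]; last by rewrite cards0.
  by rewrite -setI_eq0 finset.setI0.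
have lt_n (i : 'I_s) (j : 'I_w) : i * w + j < n.
  apply: leq_trans le_sw_n; apply: (@leq_trans (i.+1 * w)).
    by rewrite mulSn addnC ltn_add2r.
  by rewrite leq_mul2r ltn_ord orbT.
exists (fun i => [set Ordinal (lt_n i j) | j : 'I_w]); split=> [i j|i].
  apply: contraR => /pred0Pn[x /andP[/imsetP[k _ ->]]].
  case/imsetP=> l _ /(congr1 val) /= e.
  apply/eqP/val_inj; move/(congr1 (divn^~ w)): e.
  by rewrite !divnMDl // !divn_small // !addn0.
rewrite card_imset ?card_ord // => k l /(congr1 val) /= /addnI; exact: val_inj.
Qed.

Theorem theorem9 (R : realType) (mu : seq nat)
    (mu_sorted : sorted geq mu) (mu_pos : all (leq 1) mu)
    (eps : R) (eps_gt0 : (0 < eps)%R) :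
  infinite_set
    [set l1 : nat | head 0 mu <= l1 /\
       let la := l1 :: mu in
       let n := sumn la in
       exists D : {set 'S_n},
         [/\ D != finset.set0,
             lambda_transitive la D
           & (#|D|%:R / (n`!)%:R < eps :> R)%R]]%classic.
Proof.
pose s := Num.Def.archi_bound eps^-1%R.
have eps_s : (((2 ^ s)%N%:R : R)^-1 < eps)%R.
  rewrite invf_plt ?posrE ?ltr0n ?expn_gt0 //.
  apply: lt_trans (archi_boundP _) _; first by rewrite invr_ge0 ltW.
  by rewrite ltr_nat ltn_expl.
(* One more than the number of parts of [l1 :: mu], for the pigeonhole. *)
pose w := (size mu).+2; pose N := (head 0 mu + s * w)%N.
suff large l1 : (N <= l1)%N -> exists D : {set 'S_(sumn (l1 :: mu))},
    [/\ D != finset.set0, lambda_transitive (l1 :: mu) D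
      & (#|D|%:R / ((sumn (l1 :: mu))`!)%:R < eps :> R)%R].
  (* A finite set containing every [l1 >= N] would make [nat] finite. *)
  move=> fin; apply: infinite_nat.
  apply: (@sub_finite_set _ _ (`I_N `|` _)%classic); last first.
    by rewrite finite_setU; split; [exact: finite_II | exact: fin].
  move=> l1 _; have [lt_l1N|le_Nl1] := ltnP l1 N; [by left | right; split].
    by apply: leq_trans le_Nl1; apply: leq_addr.
  exact: large.
move=> N_l1; set n := sumn _.
have [|B [B_disj B_w]] := @exists_blocks n s w.
  by apply: leq_trans (leq_addr _ _); apply: leq_trans N_l1; apply: leq_addl.
have cardD : (#|even_blocks B| * 2 ^ s = n`!)%N.
  have := card_all_even_blocks B_disj; rewrite !card_ord; apply=> i.
  by rewrite B_w.
have D_gt0 : (0 < #|even_blocks B|)%N.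
  by have := fact_gt0 n; rewrite -cardD muln_gt0 => /andP[].
exists (even_blocks B); split.
- by rewrite -card_gt0.
- by apply: even_blocks_transitive => // i; rewrite B_w.
- by rewrite -cardD natrM invfM mulrA divff ?mul1r // pnatr_eq0 -lt0n.
Qed.
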